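(* On $\mathbb{R}^5$ with coordinates $(\theta,\phi,x,q,\psi)$ let $$\omega_1=d\theta-\cos(\psi)\,dx-\sin(\psi)e^{\frac{x}{3}}dq,\quad \omega_2=e^{\theta}d\phi+\sin(\psi)\,dx-\cos(\psi)e^{\frac{x}{3}}dq,\quad \omega_3=d\psi-e^{\theta}d\phi+\tfrac13e^{\frac{x}{3}}dq,$$ and let $$\tilde g=d\theta^2+e^{2\theta}d\phi^2-\left(dx^2+e^{\frac{2x}{3}}dq^2\right)+\tfrac12(\omega_1^2+\omega_2^2)-\tfrac32\,\omega_3^2 .$$ Then the coordinate functions $$\mathfrak{r}_1=e^{-\frac{x}{6}}\left(e^{-\frac{\theta}{2}}\cos(\tfrac{\psi}{2})+e^{\frac{\theta}{2}}\sin(\tfrac{\psi}{2})\phi\right),$$ $$\mathfrak{r}_2=-2e^{\frac{\theta}{2}-\frac{x}{6}}\sin(\tfrac{\psi}{2}),\qquad \mathfrak{r}_3=\tfrac{2}{3}q,$$ $$\mathfrak{r}_4=-\tfrac{1}{3}qe^{-\frac{x}{6}}\left(e^{\frac{\theta}{2}}\sin(\tfrac{\psi}{2})\phi+e^{-\frac{\theta}{2}}\cos(\tfrac{\psi}{2})\right)+e^{-\frac{x}{2}}\left(e^{\frac{\theta}{2}}\cos(\tfrac{\psi}{2})\phi-e^{-\frac{\theta}{2}}\sin(\tfrac{\psi}{2})\right),$$ $$\mathfrak{r}_5=2\cos(\tfrac{\psi}{2})e^{\frac{\theta}{2}-\frac{x}{2}}-\tfrac{2}{3}\sin(\tfrac{\psi}{2})e^{\frac{\theta}{2}-\frac{x}{6}}q$$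 map the Nurowski conformal structure $[\tilde g]$ of the maximally symmetric rolling distribution $\ker(\omega_1,\omega_2,\omega_3)$ of two hyperboloid surfaces with curvatures in the ratio $1:\frac19$ to the flat metric of Engel $$ds^2=2\,d\mathfrak{r}_1d\mathfrak{r}_5+2\,d\mathfrak{r}_2d\mathfrak{r}_4+d\mathfrak{r}_3^2;$$ precisely, $$ds^2=-\tfrac{2}{3}e^{-\frac{2}{3}x}\,\tilde g .$$
   Context: Products of 1-forms are symmetric products, and $\omega^2=\omega\omega$. The rolling distribution is the rank 2 distribution $\ker(\omega_1,\omega_2,\omega_3)$ on the 5-dimensional configuration space (circle twistor bundle) of two surfaces rolling on each other without slipping or twisting; here the two surfaces have metrics $d\theta^2+e^{2\theta}d\phi^2$ (Gauss curvature $-1$) and $dx^2+e^{2x/3}dq^2$ (Gauss curvature $-\frac19$). It is a $(2,3,5)$-distribution, i.e. a rank 2 distribution $D$ with $[D,D]$ of rank 3 and $[[D,D],D]=TM$. Nurowski's conformal structure is the conformal class of split signature $(2,3)$ metrics canonically associated to a $(2,3,5)$-distribution; for this rolling distribution it is (by a result of An and Nurowski) represented by the metric $\tilde g$ written in the statement. The distribution is called maximally symmetric when this conformal class has vanishing Weyl tensor. In the displayed identity $ds^2$ is understood as pulled back to the coordinates $(\theta,\phi,x,q,\psi)$ through the functions $\mathfrak{r}_i$. *)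

(* Defs.v *)
From HB Require Import structures.
From mathcomp Require Import all_boot all_order all_algebra.
From mathcomp Require Import all_classical all_reals all_analysis.

Set Implicit Arguments.
Unset Strict Implicit.
Unset Printing Implicit Defensive.

Import Order.TTheory GRing.Theory Num.Theory.
Import numFieldNormedType.Exports.

Local Open Scope ring_scope.

(* Tensor fields on R^n are written in the global trivialization of the
   tangent bundle: the first argument is the base point, the others are
   tangent vectors. *)
Definition form1 (R : realType) (n : nat) := 'rV[R]_n -> 'rV[R]_n -> R.
Definition form2 (R : realType) (n : nat) :=
  'rV[R]_n -> 'rV[R]_n -> 'rV[R]_n -> R.

Definition coordf {R : realType} {n : nat} (i : 'I_n) (p : 'rV[R]_n) : R :=
  p 0 i.

(* The C^k condition: C^0 is continuity, and f is C^(k+1) when f is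
   differentiable with all its first partial derivatives C^k. *)
Fixpoint is_Ck {R : realType} {n : nat} (k : nat) (f : 'rV[R]_n -> R) : Prop :=
  match k with
  | 0 => continuous f
  | k'.+1 => (forall p, differentiable f p) /\
             (forall i : 'I_n, is_Ck k' (fun p => 'D_(delta_mx 0 i) f p))
  end.

Definition smooth {R : realType} {n : nat} (f : 'rV[R]_n -> R) : Prop :=
  forall k, is_Ck k f.

Definition ext_d {R : realType} {n : nat} (f : 'rV[R]_n -> R) : form1 R n :=
  fun p v => 'd f p v.

(* Products of 1-forms are symmetrized with weight 1/2, so that
   (sprod a a) p v v = (a p v)^2. *)
Definition sprod {R : realType} {n : nat} (a b : form1 R n) : form2 R n :=
  fun p v w => (a p v * b p w + a p w * b p v) / 2.

Definition ssqr {R : realType} {n : nat} (a : form1 R n) : form2 R n :=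
  sprod a a.

Definition pullback {R : realType} {m n : nat} (f : 'rV[R]_m -> 'rV[R]_n)
    (h : form2 R n) : form2 R m :=
  fun p v w => h (f p) ('d f p v) ('d f p w).

(* h lies in the conformal class [g].  The factor may be negative: a conformal
   class of split signature (2,3) does not distinguish g from -g. *)
Definition conformal {R : realType} {n : nat} (g h : form2 R n) : Prop :=
  exists lam : 'rV[R]_n -> R,
    [/\ smooth lam, (forall p, lam p != 0)
      & forall p v w, h p v w = lam p * g p v w].

(* The components of f are local coordinates around every point. *)
Definition local_coordinates {R : realType} {n : nat}
    (f : 'rV[R]_n -> 'rV[R]_n) : Prop :=
  [/\ (forall i : 'I_n, smooth (fun p => f p 0 i)),
      (forall p, differentiable f p)
    & forall p, jacobian f p \in unitmx].

Definition conformal_map {R : realType} {n : nat}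
    (f : 'rV[R]_n -> 'rV[R]_n) (g h : form2 R n) : Prop :=
  local_coordinates f /\ conformal g (pullback f h).

(* The coordinates (theta, phi, x, q, psi). *)
Definition ctheta {R : realType} : 'rV[R]_5 -> R := coordf (@Ordinal 5 0 isT).
Definition cphi {R : realType} : 'rV[R]_5 -> R := coordf (@Ordinal 5 1 isT).
Definition cx {R : realType} : 'rV[R]_5 -> R := coordf (@Ordinal 5 2 isT).
Definition cq {R : realType} : 'rV[R]_5 -> R := coordf (@Ordinal 5 3 isT).
Definition cpsi {R : realType} : 'rV[R]_5 -> R := coordf (@Ordinal 5 4 isT).

Definition omega1 {R : realType} : form1 R 5 := fun p v =>
  ext_d ctheta p v - cos (cpsi p) * ext_d cx p v
  - sin (cpsi p) * expR (cx p / 3) * ext_d cq p v.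

Definition omega2 {R : realType} : form1 R 5 := fun p v =>
  expR (ctheta p) * ext_d cphi p v + sin (cpsi p) * ext_d cx p v
  - cos (cpsi p) * expR (cx p / 3) * ext_d cq p v.

Definition omega3 {R : realType} : form1 R 5 := fun p v =>
  ext_d cpsi p v - expR (ctheta p) * ext_d cphi p v
  + 1 / 3 * expR (cx p / 3) * ext_d cq p v.

(* The representative of Nurowski's conformal structure of the rolling
   distribution ker (omega1, omega2, omega3). *)
Definition nurowski_metric {R : realType} : form2 R 5 := fun p v w =>
  ssqr (ext_d ctheta) p v w
  + expR (2 * ctheta p) * ssqr (ext_d cphi) p v w
  - (ssqr (ext_d cx) p v w + expR (2 * cx p / 3) * ssqr (ext_d cq) p v w)
  + 1 / 2 * (ssqr omega1 p v w + ssqr omega2 p v w)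
  - 3 / 2 * ssqr omega3 p v w.

Definition r1 {R : realType} (p : 'rV[R]_5) : R :=
  expR (- (cx p / 6)) *
  (expR (- (ctheta p / 2)) * cos (cpsi p / 2)
   + expR (ctheta p / 2) * sin (cpsi p / 2) * cphi p).

Definition r2 {R : realType} (p : 'rV[R]_5) : R :=
  - 2 * expR (ctheta p / 2 - cx p / 6) * sin (cpsi p / 2).

Definition r3 {R : realType} (p : 'rV[R]_5) : R := 2 / 3 * cq p.

Definition r4 {R : realType} (p : 'rV[R]_5) : R :=
  - (1 / 3) * cq p * expR (- (cx p / 6)) *
    (expR (ctheta p / 2) * sin (cpsi p / 2) * cphi p
     + expR (- (ctheta p / 2)) * cos (cpsi p / 2))
  + expR (- (cx p / 2)) *
    (expR (ctheta p / 2) * cos (cpsi p / 2) * cphi p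
     - expR (- (ctheta p / 2)) * sin (cpsi p / 2)).

Definition r5 {R : realType} (p : 'rV[R]_5) : R :=
  2 * cos (cpsi p / 2) * expR (ctheta p / 2 - cx p / 2)
  - 2 / 3 * sin (cpsi p / 2) * expR (ctheta p / 2 - cx p / 6) * cq p.

Definition engel_map {R : realType} (p : 'rV[R]_5) : 'rV[R]_5 :=
  \row_(i < 5) nth 0 [:: r1 p; r2 p; r3 p; r4 p; r5 p] i.

(* Engel's metric on the target R^5, in its standard coordinates
   y_1, ..., y_5; the coordinate y_i has index i - 1. *)
Definition engel_metric {R : realType} : form2 R 5 := fun p v w =>
  let dy (i : 'I_5) := ext_d (coordf i) in
  2 * sprod (dy (@Ordinal 5 0 isT)) (dy (@Ordinal 5 4 isT)) p v w
  + 2 * sprod (dy (@Ordinal 5 1 isT)) (dy (@Ordinal 5 3 isT)) p v w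
  + ssqr (dy (@Ordinal 5 2 isT)) p v w.

(* Main.v *)
Require Import Defs.
From HB Require Import structures.
From mathcomp Require Import all_boot all_order all_algebra.
From mathcomp Require Import all_classical all_reals all_analysis.
From mathcomp Require Import ring lra.
Import Order.TTheory GRing.Theory Num.Theory.
Import numFieldNormedType.Exports.
Local Open Scope ring_scope.

(** In a = e^(theta/2), b = e^(-x/6), C = cos(psi/2) and S = sin(psi/2), the
    components of the map, its differential and the Nurowski metric are Laurent
    polynomials in a and b and polynomials in C, S, phi, q and tangent
    coordinates, so the conformal identity is checked modulo C^2 = 1 - S^2.
    The differential is injective because, after removal of the nonvanishing
    factors a and b, rotating the pairs (dr_2, dr_5) and (dr_1, dr_4) by the
    angle psi/2 solves the system dr_1 = ... = dr_5 = 0 explicitly. *)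

(** * Chain rule and coordinate functions *)

Lemma is_diff_comp_derive (R : realType) (V : normedModType R) (f df : V -> R)
    (h : R -> R) (h' : R) (p : V) :
  is_diff p f df -> is_derive (f p) 1 h h' ->
  is_diff p (fun y => h (f y)) (fun v => h' * df v).
Proof.
move=> fdf [dh hE].
have dfh : is_diff (f p) h (fun t => h' * t).
  apply: DiffDef; first exact/derivable1_diffP.
  apply/funext => t; rewrite diff1E; last exact/derivable1_diffP.
  by rewrite derive1E hE mulrC.
exact: is_diff_comp.
Qed.

(** A coordinate is linear and continuous, hence its own differential; the linear structure is
    packed by hand so that [diff_lin] applies. As an instance it lets [diff_val] compute
    [ext_d (coordf i)]. *)
Global Instance is_diff_coordf (R : realType) (n : nat) (i : 'I_n)
    (p : 'rV[R]_n) :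
  is_diff p (coordf i) (coordf i).
Proof.
apply: DiffDef; first exact: differentiable_coord.
have lin : linear (fun M : 'rV[R]_n => M 0 i) by move=> a u v; rewrite !mxE.
pose L := GRing.isLinear.Build _ _ _ _ _ lin.
pose f : {linear 'rV[R]_n -> R} := HB.pack (fun M : 'rV[R]_n => M 0 i) L.
rewrite (_ : coordf i = f) // diff_lin //; exact: coord_continuous.
Qed.

(** * Closure properties of the classes [is_Ck] *)

Section Smoothness.
Variables (R : realType) (n : nat).
Implicit Types (f g : 'rV[R]_n -> R) (k : nat).

Lemma is_CkS k f : is_Ck k.+1 f <->
  (forall p, differentiable f p) /\ (forall i, is_Ck k ('D_(delta_mx 0 i) f)).
Proof. by []. Qed.

Lemma is_CkW k f : is_Ck k.+1 f -> is_Ck k f.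
Proof.
elim: k f => [|k IH] f /is_CkS[df Df].
  by move=> p; exact: differentiable_continuous.
by split=> // i; exact: IH.
Qed.

Lemma is_Ck_cst k (c : R) : is_Ck k (fun _ : 'rV[R]_n => c).
Proof.
elim: k c => [|k IH] c; first by move=> p; exact: cst_continuous.
split=> [p|i]; first exact: differentiable_cst.
by under eq_fun do rewrite derive_cst; exact: IH.
Qed.

Lemma is_Ck_coordf k (i : 'I_n) : is_Ck k (@coordf R n i).
Proof.
case: k => [|k]; first by move=> p; exact: coord_continuous.
split=> [p|j]; first exact: differentiable_coord.
rewrite (_ : (fun p => _) = fun=> coordf i (delta_mx 0 j)).
  exact: is_Ck_cst.
apply/funext => p; rewrite deriveE ?diff_val //; exact: differentiable_coord.
Qed.

Lemma is_CkD k f g : is_Ck k f -> is_Ck k g -> is_Ck k (fun p => f p + g p).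
Proof.
elim: k f g => [|k IH] f g; first by move=> cf cg p; exact: cvgD (cf p) (cg p).
move=> /is_CkS[df Df] /is_CkS[dg Dg]; apply/is_CkS.
split=> [p|i]; first exact: differentiableD.
rewrite (_ : (fun p => _) =
  fun p => 'D_(delta_mx 0 i) f p + 'D_(delta_mx 0 i) g p); first by apply: IH.
by apply/funext => p; rewrite deriveD //; exact: diff_derivable.
Qed.

Lemma is_CkM k f g : is_Ck k f -> is_Ck k g -> is_Ck k (fun p => f p * g p).
Proof.
elim: k f g => [|k IH] f g; first by move=> cf cg p; exact: cvgM (cf p) (cg p).
move=> Cf Cg; have [df Df] := (is_CkS _ _).1 Cf.
have [dg Dg] := (is_CkS _ _).1 Cg.
apply/is_CkS; split=> [p|i]; first exact: differentiableM.
rewrite (_ : (fun p => _) = fun p =>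
  f p * 'D_(delta_mx 0 i) g p + g p * 'D_(delta_mx 0 i) f p).
  (* The Leibniz rule involves [f] and [g] themselves at order [k], which [is_CkW] supplies from
     order [k.+1]. *)
  by apply: is_CkD; apply: IH => //; exact: is_CkW.
by apply/funext => p; rewrite deriveM //; exact: diff_derivable.
Qed.

Lemma is_CkN k f : is_Ck k f -> is_Ck k (fun p => - f p).
Proof.
move=> Cf; under eq_fun do rewrite -mulN1r.
by apply: is_CkM => //; exact: is_Ck_cst.
Qed.

(* Quantifying over a class P closed under differentiation lets the induction
   treat cos and sin simultaneously. *)
Lemma is_Ck_comp (P : (R -> R) -> Prop) :
  (forall h, P h -> exists2 h', P h' & forall x : R, is_derive x 1 h (h' x)) ->
  forall k h f, P h -> is_Ck k f -> is_Ck k (fun p => h (f p)).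
Proof.
move=> PD; have Pdiff h x : P h -> differentiable h x.
  by move=> /PD[h' _ /(_ x)[dh _]]; exact/derivable1_diffP.
elim=> [|k IH] h f Ph Cf.
  move=> p; apply: continuous_comp; first exact: Cf.
  exact/differentiable_continuous/Pdiff.
have [df Df] := (is_CkS _ _).1 Cf; have [h' Ph' hh'] := PD h Ph.
apply/is_CkS; split=> [p|i].
  by apply: differentiable_comp => //; exact: Pdiff.
rewrite (_ : (fun p => _) = fun p => h' (f p) * 'D_(delta_mx 0 i) f p).
  by apply: is_CkM => //; apply: IH => //; exact: is_CkW.
apply/funext => p.
have D := is_diff_comp_derive _ _ _ _ _ _ _ (differentiableP (df p)) (hh' (f p)).
by rewrite !deriveE // diff_val.
Qed.

Lemma is_Ck_expR k f : is_Ck k f -> is_Ck k (fun p => expR (f p)).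
Proof.
apply: (is_Ck_comp (eq expR)) => // _ <-; exists expR => // x.
exact: is_derive_expR.
Qed.

(** The span of cos and sin: it contains both and is stable under differentiation, as [is_Ck_comp]
    demands of its class [P]. *)
Let trig (h : R -> R) := exists a b, h = fun x => a * cos x + b * sin x.

Let trig_derive h : trig h ->
  exists2 h', trig h' & forall x : R, is_derive x 1 h (h' x).
Proof.
move=> [a [b ->]]; exists (fun x => b * cos x + (- a) * sin x).
  by exists b, (- a).
by move=> x; apply: is_derive_eq; rewrite /= /GRing.scale /=; ring.
Qed.

Lemma is_Ck_cos k f : is_Ck k f -> is_Ck k (fun p => cos (f p)).
Proof.
apply: (is_Ck_comp _ trig_derive _ cos); exists 1, 0.
by apply/funext => x; rewrite mul1r mul0r addr0.
Qed.

Lemma is_Ck_sin k f : is_Ck k f -> is_Ck k (fun p => sin (f p)).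
Proof.
apply: (is_Ck_comp _ trig_derive _ sin); exists 0, 1.
by apply/funext => x; rewrite mul1r mul0r add0r.
Qed.

End Smoothness.

(** * Differentials of row-valued maps and of pointwise expressions *)

Lemma is_diff_row (R : realType) (V : normedModType R) (n : nat)
    (f df : 'I_n -> V -> R) (p : V) :
  (forall i, is_diff p (f i) (df i)) ->
  is_diff p (fun q => \row_i f i q) (fun v => \row_i df i v).
Proof.
move=> fdf; have dF : differentiable (fun q => \row_i f i q) p.
  rewrite (_ : (fun q => _) = \sum_i (fun q => f i q *: delta_mx 0 i)).
    by apply: differentiable_sum => i; apply: differentiableZl.
  by apply/funext => q; rewrite fct_sumE [LHS]row_sum_delta;
    under eq_bigr do rewrite mxE.
apply: DiffDef => //; apply/funext => v; apply/rowP => i.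
(* The differential is identified one component at a time, by the chain rule for the [i]-th
   coordinate after the row map. *)
have D := is_diff_comp (differentiableP dF) (is_diff_coordf _ _ i _).
have E : coordf i \o (fun q => \row_i f i q) = f i.
  by apply/funext => q; rewrite /coordf /= mxE.
have dE : 'd (coordf i \o (fun q => \row_i f i q)) p =
  coordf i \o 'd (fun q => \row_i f i q) p :> (V -> R) by exact: diff_val.
have dfE : 'd (f i) p = df i :> (V -> R) by exact: diff_val.
by rewrite mxE -dfE -E dE.
Qed.

Section PointwiseDifferentials.
Variables (R : realType) (V : normedModType R) (f df g dg : V -> R) (p : V).
Hypotheses (fdf : is_diff p f df) (gdg : is_diff p g dg).

(** This and the following rules are stated for explicit lambdas, so that the differential of a
    formula can be built by following its syntax. *)
Lemma is_diff_const (c : R) : is_diff p (fun _ => c) (fun _ => 0).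
Proof. exact: is_diff_cst. Qed.

Lemma is_diff_add : is_diff p (fun y => f y + g y) (fun v => df v + dg v).
Proof. exact: is_diffD. Qed.

Lemma is_diff_opp : is_diff p (fun y => - f y) (fun v => - df v).
Proof. exact: is_diffN. Qed.

Lemma is_diff_mul :
  is_diff p (fun y => f y * g y) (fun v => f p * dg v + g p * df v).
Proof. exact: is_diffM. Qed.

Lemma is_diff_expR :
  is_diff p (fun y => expR (f y)) (fun v => expR (f p) * df v).
Proof. exact: is_diff_comp_derive. Qed.

Lemma is_diff_cos :
  is_diff p (fun y => cos (f y)) (fun v => - sin (f p) * df v).
Proof. exact: is_diff_comp_derive. Qed.

Lemma is_diff_sin :
  is_diff p (fun y => sin (f y)) (fun v => cos (f p) * df v).
Proof. exact: is_diff_comp_derive. Qed.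

End PointwiseDifferentials.

(** * Smoothness and explicit differential of the Engel map *)

Lemma smooth_engel_map (R : realType) (i : 'I_5) :
  smooth (fun p => @engel_map R p 0 i).
Proof.
move=> k; rewrite /engel_map; under eq_fun do rewrite mxE.
case: i => -[|[|[|[|[|i]]]]] //= _; rewrite /r1 /r2 /r3 /r4 /r5;
  do ![exact: is_Ck_cst | exact: is_Ck_coordf | apply: is_CkD | apply: is_CkM
   | apply: is_CkN | apply: is_Ck_expR | apply: is_Ck_cos | apply: is_Ck_sin].
Qed.

(** The entries stay factored: the brackets multiplying powers of [a] and [b] are the quantities
    [A], [B], [U], [W] of the injectivity proof. The last two entries reflect r4 = -q r1/3 + ... and
    r5 = q r2/3 + ... . *)
Definition engel_diff {R : realType} (i : 'I_5) (p v : 'rV[R]_5) : R :=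
  let a := expR (ctheta p / 2) in let b := expR (- (cx p / 6)) in
  let C := cos (cpsi p / 2) in let S := sin (cpsi p / 2) in
  let dt := ctheta v in let df := cphi v in
  let dx := cx v in let dq := cq v in let ds := cpsi v in
  let f := cphi p in let q := cq p in
  nth 0 [::
    b * (a^-1 * (- (dx / 6 + dt / 2) * C - S * ds / 2)
         + a * ((dt / 2 - dx / 6) * S * f + C * ds / 2 * f + S * df));
    - 2 * a * b * ((dt / 2 - dx / 6) * S + C * ds / 2);
    2 / 3 * dq;
    - (1 / 3) * (dq * b * (a * S * f + a^-1 * C)
      + q * b * (a^-1 * (- (dx / 6 + dt / 2) * C - S * ds / 2)
         + a * ((dt / 2 - dx / 6) * S * f + C * ds / 2 * f + S * df)))
    + b ^+ 3 * (a * ((dt / 2 - dx / 2) * C * f - S * ds / 2 * f + C * df)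
                - a^-1 * (- (dx / 2 + dt / 2) * S + C * ds / 2));
    2 * a * b ^+ 3 * ((dt / 2 - dx / 2) * C - S * ds / 2)
    - 2 / 3 * a * b * (((dt / 2 - dx / 6) * S + C * ds / 2) * q + S * dq)] i.

Lemma engel_exp (R : realType) (t x : R) :
  [/\ expR (- (t / 2)) = (expR (t / 2))^-1,
      expR (- (x / 2)) = expR (- (x / 6)) ^+ 3,
      expR (t / 2 - x / 6) = expR (t / 2) * expR (- (x / 6))
    & expR (t / 2 - x / 2) = expR (t / 2) * expR (- (x / 6)) ^+ 3].
Proof.
have E : expR (- (x / 2)) = expR (- (x / 6)) ^+ 3.
  by rewrite -expRM_natl; congr expR; field.
split; [exact: expRN | exact: E | exact: expRD | by rewrite expRD E].
Qed.

Lemma is_diff_engel_map (R : realType) (p : 'rV[R]_5) :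
  is_diff p (@engel_map R) (fun v => \row_i engel_diff i p v).
Proof.
apply: is_diff_row => i; rewrite /engel_diff.
have [e1 e2 e3 e4] := engel_exp _ (ctheta p) (cx p).
case: i => -[|[|[|[|[|i]]]]] //= _; rewrite /r1 /r2 /r3 /r4 /r5;
  (apply: is_diff_eq;
    repeat first [exact: is_diff_const | exact: is_diff_coordf
      | apply: is_diff_add | apply: is_diff_mul | apply: is_diff_opp
      | apply: is_diff_expR | apply: is_diff_cos | apply: is_diff_sin]);
  apply/funext => v;
  rewrite ?e1 ?e2 ?e3 ?e4; have z : (0 : 'rV[R]_5 -> R) v = 0 by [].
all: rewrite ?scaler0 ?add0r ?fctE ?z /ctheta /cphi /cx /cq /cpsi /GRing.scale /=.
all: by field; rewrite ?expR_eq0.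
Qed.

Lemma ext_d_coordf (R : realType) (n : nat) (i : 'I_n) (p v : 'rV[R]_n) :
  ext_d (coordf i) p v = coordf i v.
Proof. by rewrite /ext_d diff_val. Qed.

Lemma diff_engel_map (R : realType) (p v : 'rV[R]_5) (i : 'I_5) :
  'd (@engel_map R) p v 0 i = engel_diff i p v.
Proof. by have D := is_diff_engel_map _ p; rewrite diff_val mxE. Qed.

(** * The conformal identity *)

Lemma pullback_engel_metric (R : realType) (p v w : 'rV[R]_5) :
  pullback (@engel_map R) (@engel_metric R) p v w
     = - (2 / 3) * expR (- (2 / 3) * cx p) * nurowski_metric p v w.
Proof.
have expx3 : expR (cx p / 3) = expR (- (cx p / 6)) ^- 2.
  by rewrite -expRM_natl -expRN; congr expR; field.
have exp2x3 : expR (2 * cx p / 3) = expR (- (cx p / 6)) ^- 4.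
  by rewrite -expRM_natl -expRN; congr expR; field.
have expN2x3 : expR (- (2 / 3) * cx p) = expR (- (cx p / 6)) ^+ 4.
  by rewrite -expRM_natl; congr expR; field.
have expt : expR (ctheta p) = expR (ctheta p / 2) ^+ 2.
  by rewrite -expRM_natl; congr expR; field.
have exp2t : expR (2 * ctheta p) = expR (ctheta p / 2) ^+ 4.
  by rewrite -expRM_natl; congr expR; field.
have psiE : cpsi p = (cpsi p / 2) *+ 2 by rewrite mulr2n -splitr.
have C2 := cos2sin2 (cpsi p / 2).
(* The double angle is written without C^2, in line with the reduction C^2 = 1 - S^2 used at the
   end. *)
have cE : cos (cpsi p) = 1 - 2 * sin (cpsi p / 2) ^+ 2.
  by rewrite [in LHS]psiE cos_mulr2n C2; ring.
have sE : sin (cpsi p) = 2 * sin (cpsi p / 2) * cos (cpsi p / 2).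
  by rewrite [in LHS]psiE sin_mulr2n; ring.
rewrite /pullback /engel_metric /nurowski_metric /ssqr /sprod.
rewrite /omega1 /omega2 /omega3.
rewrite !ext_d_coordf expx3 exp2x3 expN2x3 expt exp2t cE sE.
rewrite /coordf !diff_engel_map /engel_diff /=.
(* The exponentials and half-angle functions become free variables, subject only to a, b nonzero and
   C^2 = 1 - S^2. *)
move: (expR_eq0 (ctheta p / 2)) (expR_eq0 (- (cx p / 6))) C2.
move: (expR _) (expR _) (cos _) (sin _) => a b C S /negbT a0 /negbT b0 C2.
rewrite /ctheta /cphi /cx /cq /cpsi /coordf.
by field: C2; rewrite a0 b0.
Qed.

(** * Injectivity of the differential *)

Lemma diff_engel_map_inj (R : realType) (p v : 'rV[R]_5) :
  'd (@engel_map R) p v = 0 -> v = 0.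
Proof.
move=> /rowP dF0.
have d0 i : engel_diff i p v = 0 by rewrite -diff_engel_map dF0 mxE.
move: (d0 0) (d0 1) (d0 2%:R) (d0 3%:R) (d0 4%:R) => {dF0 d0}.
have C2 := cos2sin2 (cpsi p / 2).
have [a0 b0] : expR (ctheta p / 2) != 0 /\ expR (- (cx p / 6)) != 0.
  by rewrite !expR_eq0.
rewrite /engel_diff /=; move: C2 a0 b0.
move: (expR (ctheta p / 2)) (expR (- (cx p / 6))) (cos _) (sin _).
move=> a b C S C2 a0 b0.
(* Up to nonzero factors, [A] is dr2 and [U] is dr1; [B] is dr5 modulo dr2 and dq, and [W] is dr4
   modulo dr1 and dq. *)
set A := (ctheta v / 2 - cx v / 6) * S + C * cpsi v / 2.
set B := (ctheta v / 2 - cx v / 2) * C - S * cpsi v / 2.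
set U := a^-1 * _ + _; set W := a * _ - _ => H0 H1 H2 H3 H4.
have q0 : cq v = 0 by lra.
have A0 : A = 0.
  have nz : -2 * a * b != 0 by rewrite !mulf_neq0 // oppr_eq0 pnatr_eq0.
  by apply: (mulfI nz); rewrite mulr0.
have B0 : B = 0.
  have nz : 2 * a * b ^+ 3 != 0 by rewrite !mulf_neq0 ?expf_neq0 // pnatr_eq0.
  by apply: (mulfI nz); rewrite mulr0 -[RHS]H4 A0 q0; ring.
have U0 : U = 0 by apply: (mulfI b0); rewrite mulr0.
have W0 : W = 0.
  have nz : b ^+ 3 != 0 by rewrite expf_neq0.
  by apply: (mulfI nz); rewrite mulr0 -[RHS]H3 U0 q0; ring.
have x0 : cx v = 0.
  (* Here A S + B C = dtheta/2 - (S^2/6 + C^2/2) dx, while the rotated pair (U, W), freed of its a^2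
     terms, gives -dtheta/2 - (C^2/6 + S^2/2) dx. The sum is -(2/3) dx; the dphi terms cancel once A
     = B = 0. *)
  have -> : cx v = - (3 / 2) * (B * C + A * S
      + C * (a * U - a ^+ 2 * (cphi p * A + S * cphi v))
      - S * (a * W - a ^+ 2 * (cphi p * B + C * cphi v))).
    by rewrite /A /B /U /W; field: C2.
  by rewrite A0 B0 U0 W0; ring.
have t0 : ctheta v = 0.
  have -> : ctheta v = 2 * (A * S + B * C) + cx v * (S ^+ 2 / 3 + C ^+ 2).
    by rewrite /A /B; field: C2.
  by rewrite A0 B0 x0; ring.
have s0 : cpsi v = 0.
  (* The complementary rotation A C - B S equals dpsi/2 + S C dx/3: dtheta drops out. *)
  have -> : cpsi v = 2 * (A * C - B * S) - 2 / 3 * cx v * S * C.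
    by rewrite /A /B; field: C2.
  by rewrite A0 B0 x0; ring.
have f0 : cphi v = 0.
  (* In S U + C W the dphi terms add up to a dphi, since S^2 + C^2 = 1, and dtheta cancels. *)
  have -> : cphi v = a^-1 * (S * U + C * W) - cphi p * (S * A + C * B)
      + a ^- 2 * (cpsi v / 2 - cx v / 3 * S * C).
    by rewrite /A /B /U /W; field: C2.
  by rewrite A0 B0 U0 W0 x0 s0; ring.
apply/rowP => i; rewrite mxE; move: t0 f0 x0 q0 s0.
rewrite /ctheta /cphi /cx /cq /cpsi /coordf.
by case: i => -[|[|[|[|[|i]]]]] //= ? t0 f0 x0 q0 s0;
  [rewrite -t0 | rewrite -f0 | rewrite -x0 | rewrite -q0 | rewrite -s0];
  congr (v _ _); exact/val_inj.
Qed.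

Theorem proposition3p2 (R : realType) :
  conformal_map (@engel_map R) (@nurowski_metric R) (@engel_metric R) /\
  (forall p v w : 'rV[R]_5,
     pullback (@engel_map R) (@engel_metric R) p v w
     = - (2 / 3) * expR (- (2 / 3) * cx p) * nurowski_metric p v w).
Proof.
split; last exact: pullback_engel_metric.
split.
  split=> [i|p|p]; first exact: smooth_engel_map.
    by have D := is_diff_engel_map _ p; exact: ex_diff.
  (* A square matrix with trivial left kernel is invertible, and a row vector times the Jacobian is
     the differential applied to it. *)
  rewrite -row_free_unit; apply: inj_row_free => v.
  by rewrite /jacobian mul_rV_lin1; exact: diff_engel_map_inj.
exists (fun p => - (2 / 3) * expR (- (2 / 3) * cx p)); split=> [k|p|].
- by apply: is_CkM; [exact: is_Ck_cst|apply: is_Ck_expR; apply: is_CkM;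
    [exact: is_Ck_cst | exact: is_Ck_coordf]].
- by rewrite mulf_neq0 ?expR_eq0 // oppr_eq0 mulf_neq0 ?invr_eq0 ?pnatr_eq0.
- exact: pullback_engel_metric.
Qed.
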